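(* For every field $\mathbb{K}$, $\mathcal{G}'+\mathcal{G}'=\mathbb{K}((t^{-1}))$.
   Context: $\mathbb{K}((t^{-1}))$ is the field of formal Laurent series $\sum_{n=-\infty}^{\infty}\alpha_n t^{-n}$ over the field $\mathbb{K}$ (only finitely many nonzero $\alpha_n$ with $n<0$), with $\deg\alpha=\sup\{-n:\alpha_n\ne0\}$. Every $\alpha$ has a unique continued fraction expansion $[a_0;a_1,a_2,\dots]$ with $a_n\in\mathbb{K}[t]$, $\deg a_n\ge1$ for $n\ge1$, finite iff $\alpha\in\mathbb{K}(t)$. $a_n(\alpha)$ is the $n$-th partial quotient (when defined) and $d_n(\alpha)=\deg a_n(\alpha)$. $\mathcal{G}'=\{\alpha\in\mathbb{K}((t^{-1})): d_n(\alpha)<d_{n+1}(\alpha) \text{ for every } n\ge1 \text{ such that } a_{n+1}(\alpha) \text{ is defined}\}$. *)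

(* Defs.v *)
From HB Require Import structures.
From mathcomp Require Import all_boot all_order all_algebra.
Set Implicit Arguments. Unset Strict Implicit. Unset Printing Implicit Defensive.
Import Order.TTheory GRing.Theory Num.Theory.
Local Open Scope ring_scope.

Section Laurent.
Variable K : fieldType.

(* A coefficient family c : int -> K, where  c k  is the coefficient of t^k.
   (In the paper's notation alpha = sum_n alpha_n t^{-n}, so c k = alpha_{-k}.)
   It is a Laurent series in t^{-1} iff only finitely many nonzero
   coefficients of positive degree occur, i.e. c k = 0 for k large. *)
Definition is_laurent (c : int -> K) : Prop :=
  exists M : int, forall k : int, M < k -> c k = 0.

Record laurent := Laurent {
  lcoef :> int -> K;
  lcoef_bounded : is_laurent lcoef }.

Definition lpoly (p : {poly K}) (k : int) : K :=
  match k with Posz i => p`_i | Negz _ => 0 end.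

Definition lone : int -> K := lpoly 1.

Definition lsub (f g : int -> K) (k : int) : K := f k - g k.

(* h = f * g (Cauchy product); the sum is over all i with f_i g_{k-i}
   possibly nonzero, given upper bounds Mf, Mg of the supports. *)
Definition is_prod (f g h : int -> K) : Prop :=
  exists Mf Mg : int,
    (forall k, Mf < k -> f k = 0) /\ (forall k, Mg < k -> g k = 0) /\
    forall k, h k = \sum_(j < (absz (Mf + Mg - k)%R).+1)
                       f (Mf - j%:Z) * g (k - Mf + j%:Z).

Definition is_polypart (c : int -> K) (p : {poly K}) : Prop :=
  forall i : nat, p`_i = c (Posz i).

Definition cf_next (c beta : int -> K) : Prop :=
  exists a : {poly K}, is_polypart c a /\
    (exists k, lsub c (lpoly a) k != 0) /\
    is_prod (lsub c (lpoly a)) beta lone.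

Inductive complete_quotient (c : int -> K) : nat -> (int -> K) -> Prop :=
| cq0 : complete_quotient c 0 c
| cqS n beta gamma : complete_quotient c n beta -> cf_next beta gamma ->
                     complete_quotient c n.+1 gamma.

Definition partial_quotient (c : int -> K) (n : nat) (a : {poly K}) : Prop :=
  exists beta, complete_quotient c n beta /\ is_polypart beta a.

Definition pdeg (p : {poly K}) : nat := (size p).-1.

Definition inGprime (alpha : laurent) : Prop :=
  forall (n : nat) (a b : {poly K}), (1 <= n)%N ->
    partial_quotient alpha n a -> partial_quotient alpha n.+1 b ->
    (pdeg a < pdeg b)%N.

End Laurent.

(* Main.v *)
(* Call D the negated degree of alpha - p/q - r/s, where p/q and r/s are finite
   continued fractions whose partial quotients have increasing degrees, the
   last ones (of index >= 1) of degrees d and e.  If D > 2 deg q + d, one more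
   partial quotient, of degree D - 2 deg q > d, can be appended to p/q so as to
   cancel the leading part of the difference.  The new denominator q' has degree
   D - deg q and the new difference satisfies D' > 2 deg q'.  The conditions
     D > 2 deg s,  D > 2 deg q + d,  2 deg s >= 2 deg q + e
   then hold again with the roles of the two fractions exchanged, so extending
   them alternately never gets stuck.  The two sequences converge, and since
   D > 2 deg q + d at each stage, the limits have these finite expansions as
   initial segments.  If the difference vanishes at some stage, the process
   stops with two rational functions. *)
Require Import Defs.
From HB Require Import structures.
From mathcomp Require Import all_boot all_order all_algebra.
From mathcomp Require Import boolp.
From mathcomp Require Import zify ring.
Set Implicit Arguments. Unset Strict Implicit. Unset Printing Implicit Defensive.
Import Order.TTheory GRing.Theory Num.Theory.
Local Open Scope ring_scope.

(** * The field of Laurent series *)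

Section LaurentField.
Variable K : fieldType.
Implicit Types (f g h : int -> K) (m n : int).

Definition deg_le f m := forall k, m < k -> f k = 0.

(* The formula of [is_prod], for the bounds [M] and [N] on the degrees. *)
Definition conv (M N : int) f g (k : int) : K :=
  \sum_(j < (absz (M + N - k)%R).+1) f (M - j%:Z) * g (k - M + j%:Z).

(* Leading coefficients in decreasing order of degree, as a polynomial in 1/t;
   products of series are computed on such truncations. *)
Definition trunc (M : int) f (r : nat) : {poly K} := \poly_(i < r) f (M - i%:Z).

(** For [k] above [M + N] the [absz] in the range still yields terms; each of them vanishes because
    it evaluates [g] above [N]. *)
Lemma conv_gt M N f g k : deg_le g N -> M + N < k -> conv M N f g k = 0.
Proof.
by move=> gN hk; apply: big1 => j _; rewrite [g _]gN ?mulr0 //; lia.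
Qed.

Lemma convE M N f g (i r : nat) : (i < r)%N ->
  conv M N f g (M + N - i%:Z) = (trunc M f r * trunc N g r)`_i.
Proof.
move=> ir; rewrite coefM /conv.
have -> : absz (M + N - (M + N - i%:Z))%R = i by lia.
apply: eq_bigr => j _; rewrite !coef_poly.
have jl := ltn_ord j.
rewrite !ifT; [|lia|lia].
by congr (_ * g _); lia.
Qed.

Lemma conv_bumpl M N f g : deg_le f M -> deg_le g N ->
  conv (M + 1) N f g =1 conv M N f g.
Proof.
move=> fM gN k; case: (ltP (M + N) k) => hk.
  rewrite (conv_gt _ gN hk); apply: big1 => -[[|j] jl] _ /=.
    by rewrite fM ?mul0r //; lia.
  by rewrite [g _]gN ?mulr0 //; lia.
rewrite /conv; have -> : absz (M + 1 + N - k)%R = (absz (M + N - k)%R).+1 by lia.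
rewrite big_ord_recl /= fM ?mul0r ?add0r; last lia.
by apply: eq_bigr => j _; congr (f _ * g _); rewrite /bump /=; lia.
Qed.

Lemma conv_bumpr M N f g : deg_le g N -> conv M (N + 1) f g =1 conv M N f g.
Proof.
move=> gN k; case: (ltP (M + N) k) => hk.
  rewrite (conv_gt _ gN hk); apply: big1 => j _.
  by rewrite [g _]gN ?mulr0 //; lia.
rewrite /conv; have -> : absz (M + (N + 1) - k)%R = (absz (M + N - k)%R).+1 by lia.
by rewrite big_ord_recr /= [g _]gN ?mulr0 ?addr0 //; lia.
Qed.

Lemma deg_le_trans f m n : m <= n -> deg_le f m -> deg_le f n.
Proof. by move=> mn fm k hk; apply: fm; apply: le_lt_trans hk. Qed.

Lemma conv_widen M N f g (r : nat) : deg_le f M -> deg_le g N ->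
  conv (M + r%:Z) N f g =1 conv M N f g /\ conv M (N + r%:Z) f g =1 conv M N f g.
Proof.
move=> fM gN; elim: r => [|r [IHl IHr]]; first by rewrite !addr0.
have -> : (r.+1)%:Z = r%:Z + 1 by lia.
rewrite !addrA; split=> k.
  by rewrite conv_bumpl //; apply: deg_le_trans fM; lia.
by rewrite conv_bumpr //; apply: deg_le_trans gN; lia.
Qed.

(** [is_prod] allows any bounds, so the product must not depend on them. Both sides are widened to
    the common maxima. *)
Lemma conv_bounds M N M' N' f g : deg_le f M -> deg_le g N ->
  deg_le f M' -> deg_le g N' -> conv M N f g =1 conv M' N' f g.
Proof.
move=> fM gN fM' gN' k.
have wide A B A' B' : deg_le f A -> deg_le g B -> A <= A' -> B <= B' ->
    conv A B f g k = conv A' B' f g k.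
  move=> fA gB AA' BB'.
  have -> : A' = A + (absz (A' - A)%R)%:Z by lia.
  have -> : B' = B + (absz (B' - B)%R)%:Z by lia.
  rewrite (conv_widen _ fA _).1 ?(conv_widen _ fA gB).2 //.
  by apply: deg_le_trans gB; lia.
rewrite (wide M N (Num.max M M') (Num.max N N')) ?le_max ?lexx //.
by rewrite -(wide M' N') ?le_max ?lexx ?orbT.
Qed.

Lemma coefM_trunc (p p' q q' : {poly K}) i :
  (forall j, (j <= i)%N -> p`_j = p'`_j) ->
  (forall j, (j <= i)%N -> q`_j = q'`_j) -> (p * q)`_i = (p' * q')`_i.
Proof.
move=> pp qq; rewrite !coefM; apply: eq_bigr => j _.
by have jl := ltn_ord j; rewrite pp ?qq //; lia.
Qed.

(** * The commutative ring of Laurent series *)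

Local Notation L := (laurent K).

Lemma laurent_eq (a b : L) : (forall k, a k = b k) -> a = b.
Proof.
case: a b => [f fP] [g gP] /= /funext fg; subst g.
by rewrite (Prop_irrelevance fP gP).
Qed.

HB.instance Definition _ := gen_eqMixin L.
HB.instance Definition _ := gen_choiceMixin L.

Lemma deg_leD f g m : deg_le f m -> deg_le g m -> deg_le (fun k => f k + g k) m.
Proof. by move=> fm gm k hk; rewrite fm ?gm ?addr0. Qed.

Fact add_laurent (a b : L) : is_laurent (fun k => a k + b k).
Proof.
case: (lcoef_bounded a) (lcoef_bounded b) => M aM [N bN].
exists (Num.max M N); apply: deg_leD.
  by apply: deg_le_trans aM; rewrite le_max lexx.
by apply: deg_le_trans bN; rewrite le_max lexx orbT.
Qed.

Fact opp_laurent (a : L) : is_laurent (fun k => - a k).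
Proof.
by case: (lcoef_bounded a) => M aM; exists M => k /aM ->; rewrite oppr0.
Qed.

Fact zero_laurent : is_laurent (fun _ => 0 : K).
Proof. by exists 0. Qed.

Definition ladd (a b : L) := Laurent (add_laurent a b).
Definition lopp (a : L) := Laurent (opp_laurent a).
Definition lzero := Laurent zero_laurent.

Fact laddA : associative ladd.
Proof. by move=> a b c; apply: laurent_eq => k /=; rewrite addrA. Qed.
Fact laddC : commutative ladd.
Proof. by move=> a b; apply: laurent_eq => k /=; rewrite addrC. Qed.
Fact ladd0 : left_id lzero ladd.
Proof. by move=> a; apply: laurent_eq => k /=; rewrite add0r. Qed.
Fact laddN : left_inverse lzero lopp ladd.
Proof. by move=> a; apply: laurent_eq => k /=; rewrite addNr. Qed.

HB.instance Definition _ := GRing.isZmodule.Build L laddA laddC ladd0 laddN.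

(** An arbitrary bound obtained by choice, possibly above the degree; [lmul_conv] makes products
    independent of it. *)
Definition lbound (a : L) : int := projT1 (cid (lcoef_bounded a)).

Lemma lboundP (a : L) : deg_le a (lbound a).
Proof. exact: projT2 (cid (lcoef_bounded a)). Qed.

Fact mul_laurent (a b : L) : is_laurent (conv (lbound a) (lbound b) a b).
Proof. by exists (lbound a + lbound b) => k; apply: conv_gt; apply: lboundP. Qed.

Definition lmul (a b : L) := Laurent (mul_laurent a b).

Lemma lmul_conv (a b : L) M N : deg_le a M -> deg_le b N ->
  lmul a b =1 conv M N a b.
Proof. by move=> aM bN; apply: conv_bounds => //; apply: lboundP. Qed.

Lemma deg_leM_lmul (a b : L) M N : deg_le a M -> deg_le b N ->
  deg_le (lmul a b) (M + N).
Proof. by move=> aM bN k hk; rewrite (lmul_conv aM bN) conv_gt. Qed.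

Lemma lmulE (a b : L) M N (i r : nat) : deg_le a M -> deg_le b N -> (i < r)%N ->
  lmul a b (M + N - i%:Z) = (trunc M a r * trunc N b r)`_i.
Proof. by move=> aM bN ir; rewrite (lmul_conv aM bN) (convE _ _ _ _ ir). Qed.

Lemma laurent_eq_below (a b : L) M : deg_le a M -> deg_le b M ->
  (forall i : nat, a (M - i%:Z) = b (M - i%:Z)) -> a = b.
Proof.
move=> aM bM ab; apply: laurent_eq => k; case: (ltP M k) => hk.
  by rewrite aM ?bM.
by have -> : k = M - (absz (M - k)%R)%:Z by lia.
Qed.

Lemma coef_trunc M f r i : (i < r)%N -> (trunc M f r)`_i = f (M - i%:Z).
Proof. by move=> ir; rewrite coef_poly ir. Qed.

Lemma coef_trunc_lmul (a b : L) M N (i r : nat) :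
  deg_le a M -> deg_le b N -> (i < r)%N ->
  (trunc (M + N) (lmul a b) r)`_i = (trunc M a r * trunc N b r)`_i.
Proof. by move=> aM bN ir; rewrite coef_trunc // (lmulE aM bN ir). Qed.

Fact lmulC : commutative lmul.
Proof.
move=> a b; have [aM bN] := (@lboundP a, @lboundP b).
apply: (laurent_eq_below (deg_leM_lmul aM bN)) => [|i].
  by rewrite addrC; apply: deg_leM_lmul.
by rewrite (lmulE aM bN (ltnSn i)) mulrC -(lmulE bN aM) // [lbound b + _]addrC.
Qed.

Fact lmulA : associative lmul.
Proof.
move=> a b c; have [[aM bN] cP] := (@lboundP a, @lboundP b, @lboundP c).
have [abM bcN] := (deg_leM_lmul aM bN, deg_leM_lmul bN cP).
apply: (laurent_eq_below (deg_leM_lmul aM bcN)) => [|i].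
  by rewrite addrA; apply: deg_leM_lmul.
rewrite (lmulE aM bcN (ltnSn i)) addrA (lmulE abM cP (ltnSn i)).
transitivity (trunc (lbound a) a i.+1 *
              (trunc (lbound b) b i.+1 * trunc (lbound c) c i.+1))`_i.
  by apply: coefM_trunc => // j ji; rewrite coef_trunc_lmul // ltnS.
by rewrite mulrA; apply: coefM_trunc => // j ji; rewrite coef_trunc_lmul // ltnS.
Qed.

Fact one_laurent : is_laurent (lone K).
Proof. by exists 0 => -[[|k]|k] // _; rewrite /lone /= coefC. Qed.

Definition lone_laurent := Laurent one_laurent.

Lemma deg_le_lone : deg_le (lone K) 0.
Proof. by case=> [[|k]|k] // _; rewrite /lone /= coefC. Qed.

Fact lmul1 : left_id lone_laurent lmul.
Proof.
move=> a; have [oM aN] := (deg_le_lone, @lboundP a).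
apply: (@laurent_eq_below _ _ (0 + lbound a)); rewrite ?add0r //.
  by rewrite -[lbound a]add0r; apply: deg_leM_lmul.
move=> i; rewrite -[lbound a]add0r (@lmulE lone_laurent _ _ _ _ _ oM aN (ltnSn i)).
have -> : trunc 0 lone_laurent i.+1 = 1.
  apply/polyP => j; rewrite coef_poly coefC; case: j => [|j] /=.
    by rewrite /lone /= coefC.
  by case: ifP => // _; rewrite sub0r -NegzE.
by rewrite mul1r coef_trunc // add0r.
Qed.

Fact lmulDl : left_distributive lmul ladd.
Proof.
move=> a b c; set M := Num.max (lbound a) (lbound b); have cN := @lboundP c.
have aM : deg_le a M by apply: deg_le_trans (@lboundP a); rewrite le_max lexx.
have bM : deg_le b M by apply: deg_le_trans (@lboundP b); rewrite le_max lexx orbT.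
have abM : deg_le (ladd a b) M by apply: deg_leD.
apply: (laurent_eq_below (deg_leM_lmul abM cN)) => [|i].
  by apply: deg_leD; apply: deg_leM_lmul.
rewrite -[RHS]/(lmul a c _ + lmul b c _).
rewrite (lmulE abM cN (ltnSn i)) (lmulE aM cN (ltnSn i)) (lmulE bM cN (ltnSn i)).
rewrite -coefD -mulrDl; apply: coefM_trunc => // j ji.
by rewrite coefD !coef_trunc.
Qed.

Fact lone_neq0 : lone_laurent != lzero.
Proof.
by apply/eqP => /(congr1 (fun a : L => a 0)) /eqP; rewrite /= /lone /= coefC oner_eq0.
Qed.

HB.instance Definition _ :=
  GRing.Zmodule_isComNzRing.Build L lmulA lmulC lmul1 lmulDl lone_neq0.

(** * Degrees and inverses *)

Definition has_deg f m := f m != 0 /\ deg_le f m.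

Lemma has_deg_ex (a : L) : a != 0 -> exists m, has_deg a m.
Proof.
move=> a0; have aM := @lboundP a; set M := lbound a in aM.
have exi : exists i : nat, a (M - i%:Z) != 0.
  apply: contrapT => /forallNP h; case/eqP: a0; apply: (laurent_eq_below aM) => [|i].
    by [].
  by apply/eqP; apply: contrapT => /negP /h.
case: (ex_minnP exi) => i ai imin; exists (M - i%:Z); split=> // k hk.
case: (ltP M k) => [/aM //|kM].
apply/eqP; apply: contraTT hk => ak.
have := imin (absz (M - k)%R).
have -> : M - (absz (M - k)%R)%:Z = k by lia.
by move=> /(_ ak); lia.
Qed.

(* The first [i.+1] coefficients of the inverse of the power series [F]. *)
Fixpoint inv_coefs (F : nat -> K) (i : nat) : seq K :=
  if i is i'.+1 then
    let l := inv_coefs F i' in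
    rcons l (- (F 0%N)^-1 * \sum_(j < i) F j.+1 * l`_(i' - j))
  else [:: (F 0%N)^-1].

Lemma size_inv_coefs F i : size (inv_coefs F i) = i.+1.
Proof. by elim: i => //= i IH; rewrite size_rcons IH. Qed.

Lemma nth_inv_coefs F i j : (j <= i)%N -> (inv_coefs F i)`_j = (inv_coefs F j)`_j.
Proof.
elim: i => [|i IH]; first by rewrite leqn0 => /eqP ->.
rewrite leq_eqVlt => /orP[/eqP -> //|ji].
by rewrite [inv_coefs F i.+1]/= nth_rcons size_inv_coefs ji IH.
Qed.

Lemma inv_coefsP F i : F 0%N != 0 ->
  \sum_(j < i.+1) F j * (inv_coefs F (i - j))`_(i - j) = (i == 0%N)%:R.
Proof.
move=> F0; rewrite big_ord_recl subn0; case: i => [|i].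
  by rewrite big_ord0 addr0 /= divff.
rewrite {1}/inv_coefs -/inv_coefs nth_rcons size_inv_coefs ltnn eqxx.
rewrite mulrA mulrN divff // mulN1r; apply/eqP; rewrite addrC subr_eq0; apply/eqP.
apply: eq_bigr => j _; rewrite lift0 subSS.
by rewrite [in RHS]nth_inv_coefs // leq_subr.
Qed.

(** Write [a] as t^m F(1/t) with F(0) nonzero; the inverse is t^(-m) times the power series 1/F in
    1/t, whose coefficients are [inv_coefs]. *)
Lemma laurent_inv_ex (a : L) : a != 0 -> exists b : L, b * a = 1.
Proof.
move=> /has_deg_ex[m [am aM]].
pose F i := a (m - i%:Z).
have F0 : F 0%N != 0 by rewrite /F subr0.
pose g k := if k <= - m then (inv_coefs F (absz (- m - k)%R))`_(absz (- m - k)%R) else 0.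
have gN : deg_le g (- m) by move=> k hk; rewrite /g leNgt hk.
pose b : L := Laurent (ex_intro _ (- m) gN).
exists b; rewrite mulrC; apply: (@laurent_eq_below _ _ 0).
- by rewrite -(subrr m); apply: deg_leM_lmul.
- exact: deg_le_lone.
move=> i; rewrite -{1}(subrr m) (@lmulE a b m (- m) i i.+1 aM gN (ltnSn i)).
rewrite coefM; transitivity ((i == 0%N)%:R : K).
  rewrite -(inv_coefsP i F0); apply: eq_bigr => j _; have jl := ltn_ord j.
  rewrite !coef_trunc //; last by rewrite ltnS leq_subr.
  congr (_ * _); rewrite /= /g ifT; last by lia.
  by have -> : absz (- m - (- m - (i - j)%N%:Z))%R = (i - j)%N by lia.
by rewrite sub0r; case: i => [|i]; rewrite /lone /= ?coefC // -NegzE.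
Qed.

Definition linv (a : L) : L :=
  if pselect (exists b : L, b * a = 1) is left h then projT1 (cid h) else 0.

Fact mulVl (a : L) : a != 0 -> linv a * a = 1.
Proof.
move=> /laurent_inv_ex h; rewrite /linv; case: pselect => // h'.
exact: projT2 (cid h').
Qed.

Fact linv0 : linv 0 = 0.
Proof.
rewrite /linv; case: pselect => // h; case/eqP: (oner_neq0 L).
by case: h => b; rewrite mulr0.
Qed.

HB.instance Definition _ := GRing.ComNzRing_isField.Build L mulVl linv0.

Lemma laurentD (a b : L) k : (a + b) k = a k + b k. Proof. by []. Qed.
Lemma laurentN (a : L) k : (- a) k = - a k. Proof. by []. Qed.

(** Translates the relation in [cf_next]: the next complete quotient is the field inverse of the
    fractional part. *)
Lemma is_prodE f (a b : L) : (exists k, f k != 0) -> f =1 a ->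
  is_prod f b (lone K) -> b = a^-1.
Proof.
move=> [k fk] /funext fa; subst f => -[Mf [Mg [aM [bN ab]]]].
have a0 : a != 0 by apply: contraNneq fk => ->.
apply: (mulfI a0); rewrite divff //; apply: laurent_eq => i.
by rewrite -[RHS]/(lone K i) ab [LHS](lmul_conv aM bN).
Qed.

Lemma deg_leN (a : L) m : deg_le a m -> deg_le (- a) m.
Proof. by move=> am k /am /= ->; rewrite oppr0. Qed.

Lemma deg_leB (a b : L) m : deg_le a m -> deg_le b m -> deg_le (a - b) m.
Proof. by move=> am /deg_leN bm; apply: deg_leD. Qed.

Lemma deg_leM (a b : L) m n : deg_le a m -> deg_le b n -> deg_le (a * b) (m + n).
Proof. exact: deg_leM_lmul. Qed.

Lemma has_degM (a b : L) m n : has_deg a m -> has_deg b n -> has_deg (a * b) (m + n).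
Proof.
move=> [am aM] [bn bN]; split; last exact: deg_leM.
rewrite -[m + n]subr0 (@lmulE a b m n 0 1 aM bN isT) coefM big_ord1.
by rewrite !coef_trunc // !subr0 mulf_neq0.
Qed.

Lemma has_deg_neq0 (a : L) m : has_deg a m -> a != 0.
Proof. by case=> am _; apply: contraNneq am => ->. Qed.

Lemma has_deg_uniq f m n : has_deg f m -> has_deg f n -> m = n.
Proof.
move=> [fm fM] [fn fN]; case: (ltgtP m n) => // [/fM|/fN] /eqP.
  by rewrite (negPf fn).
by rewrite (negPf fm).
Qed.

Lemma has_deg_le f m n : has_deg f m -> deg_le f n -> m <= n.
Proof. by move=> [fm _] fn; rewrite leNgt; apply: contra fm => /fn ->. Qed.

Lemma has_deg1 : has_deg (1 : L) 0.
Proof. by split; [rewrite /= /lone /= coefC oner_neq0 | apply: deg_le_lone]. Qed.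

Lemma has_degV (a : L) m : has_deg a m -> has_deg a^-1 (- m).
Proof.
move=> am; have a0 := has_deg_neq0 am.
have [n an] : exists n, has_deg a^-1 n by apply: has_deg_ex; rewrite invr_eq0.
have := has_degM am an; rewrite divff // => /has_deg_uniq /(_ has_deg1) mn.
by have -> : - m = n by lia.
Qed.

Lemma has_degN (a : L) m : has_deg a m -> has_deg (- a) m.
Proof. by move=> [am aM]; split; [rewrite /= oppr_eq0 | apply: deg_leN]. Qed.

Lemma has_degD (a b : L) m : has_deg a m -> deg_le b (m - 1) -> has_deg (a + b) m.
Proof.
move=> [am aM] bm; split; first by rewrite laurentD bm ?addr0 //; lia.
by apply: deg_leD => //; apply: deg_le_trans bm; lia.
Qed.

Lemma deg_le_eq0 (a : L) : (forall i : nat, deg_le a (- i%:Z)) -> a = 0.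
Proof.
by move=> ai; apply: laurent_eq => k; apply: (ai (absz k).+1); lia.
Qed.

(** * Polynomials as Laurent series, and polynomial parts *)

Fact lpoly_laurent (p : {poly K}) : is_laurent (lpoly p).
Proof. by exists (size p)%:Z => -[k|k] hk //; rewrite [LHS]nth_default //; exact: ltnW. Qed.

Definition lp (p : {poly K}) : L := Laurent (lpoly_laurent p).

Lemma has_deg_lp p : p != 0 -> has_deg (lp p) (pdeg p)%:Z.
Proof.
move=> p0; split; first by rewrite /= -/(lead_coef p) lead_coef_eq0.
by case=> [k|k] hk //; rewrite [LHS]nth_default //; exact: leq_trans (leqSpred _) hk.
Qed.

Lemma lp0 : lp 0 = 0.
Proof. by apply: laurent_eq => -[k|k] //=; rewrite coef0. Qed.

Lemma polypart_ex (a : L) : exists p, is_polypart a p.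
Proof.
have aM := @lboundP a; exists (\poly_(i < (absz (lbound a)).+1) a i%:Z) => i.
by rewrite coef_poly; case: ltnP => // hi; rewrite aM //; lia.
Qed.

Lemma polypart_deg_le (a : L) p : is_polypart a p <-> deg_le (a - lp p) (- 1).
Proof.
split=> [ap [k|k] hk|ap i]; first by rewrite /= ap subrr.
  by lia.
by apply/eqP; rewrite eq_sym -subr_eq0; apply/eqP; apply: (ap i).
Qed.

Lemma polypart_uniq f p q : is_polypart f p -> is_polypart f q -> p = q.
Proof. by move=> fp fq; apply/polyP => i; rewrite fp fq. Qed.

Lemma has_deg_polypart (a : L) p m : 0 <= m -> has_deg a m -> is_polypart a p ->
  (pdeg p)%:Z = m /\ p != 0.
Proof.
move=> m0 am /polypart_deg_le /deg_leN ap.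
have : has_deg (lp p) m.
  have -> : lp p = a + - (a - lp p) by ring.
  by apply: has_degD => //; apply: deg_le_trans ap; lia.
have [->|p0 pm] := eqVneq p 0; first by rewrite lp0 => /has_deg_neq0 /eqP.
by rewrite (has_deg_uniq (has_deg_lp p0) pm).
Qed.

End LaurentField.

(** * Continued fraction expansions *)

Section ContinuedFractions.
Variable K : fieldType.
Local Notation L := (laurent K).
Implicit Types (s w : seq {poly K}) (x y a b : L) (m n D : int).

(** The continued fraction [s_0; s_1, ..., s_(n-1), x], whose last complete quotient [x] may be any
    series. *)
Definition cfval s x : L := foldr (fun p z => lp p + z^-1) x s.

(* The partial quotient of index 0 plays no role in the degree conditions. *)
Definition tail_degs w : seq nat := map (@pdeg K) (behead w).
(** Starting the path at 0 also forces positive degrees from index 1 on. *)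
Definition increasing w := path ltn 0%N (tail_degs w).
(** The degree of the denominator of the convergent. *)
Definition den_deg w := sumn (tail_degs w).
Definition last_deg w := last 0%N (tail_degs w).

(** The condition on complete quotients of index at least 1: the inverse has negative degree and
    leaves polynomial parts unchanged. *)
Definition big a := exists2 m : int, 1 <= m & has_deg a m.

Lemma big_neq0 a : big a -> a != 0.
Proof. by case=> m _ /has_deg_neq0. Qed.

Lemma big_lp (p : {poly K}) : (0 < pdeg p)%N -> big (lp p).
Proof.
move=> pp; exists (pdeg p)%:Z; first by lia.
by apply: has_deg_lp; apply: contraTneq pp => ->; rewrite /pdeg size_poly0.
Qed.

Lemma big_addV (p : {poly K}) x : (0 < pdeg p)%N -> big x -> big (lp p + x^-1).
Proof.
move=> /big_lp[m m1 pm] [n n1 /has_degV[_ xn]]; exists m => //.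
by apply: has_degD => //; apply: deg_le_trans xn; lia.
Qed.

Lemma cfval_big s x : {in s, forall p, 0 < pdeg p}%N -> big x -> big (cfval s x).
Proof.
move=> + xb; elim: s => //= p s IH ps.
apply: big_addV; first by apply: ps; rewrite mem_head.
by apply: IH => r rs; apply: ps; rewrite inE rs orbT.
Qed.

Lemma polypart_addV (p : {poly K}) x : big x -> is_polypart (lp p + x^-1) p.
Proof.
move=> [m m1 /has_degV[_ xm]]; apply/polypart_deg_le.
rewrite addrAC subrr add0r; apply: deg_le_trans xm; lia.
Qed.

Lemma increasing_gt0 w p : increasing w -> p \in behead w -> (0 < pdeg p)%N.
Proof.
by move=> /(order_path_min ltn_trans)/allP h pw; apply: h; apply: map_f.
Qed.

Lemma mem_drop_behead w i p : p \in drop i.+1 w -> p \in behead w.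
Proof. by rewrite -addn1 -drop_drop drop1 => /mem_drop. Qed.

Lemma increasing_rcons w p : w <> [::] ->
  increasing (rcons w p) = increasing w && (last_deg w < pdeg p)%N.
Proof. by case: w => // r w _; rewrite /increasing /tail_degs /= map_rcons rcons_path. Qed.

Lemma den_deg_rcons w p : w <> [::] -> den_deg (rcons w p) = (den_deg w + pdeg p)%N.
Proof. by case: w => // r w _; rewrite /den_deg /tail_degs /= map_rcons sumn_rcons. Qed.

Lemma last_deg_rcons w p : w <> [::] -> last_deg (rcons w p) = pdeg p.
Proof. by case: w => // r w _; rewrite /last_deg /tail_degs /= map_rcons last_rcons. Qed.

(** * Reading off the partial quotients of a value of [cfval] *)

Section Expansion.
Variables (s : seq {poly K}) (x : L) (e : {poly K}).
Hypotheses (xe : is_polypart x e) (inc_se : increasing (rcons s e)).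
Hypothesis (xbig : s <> [::] -> big x).

Lemma cfval_drop_big i : (i < size s)%N -> big (cfval (drop i.+1 s) x).
Proof.
move=> si; apply: cfval_big; last by apply: xbig => s0; rewrite s0 in si.
move=> p ps; apply: (increasing_gt0 inc_se); apply: (@mem_drop_behead _ i).
by rewrite drop_rcons // mem_rcons inE ps orbT.
Qed.

Lemma cfval_drop i : (i < size s)%N ->
  cfval (drop i s) x = lp (nth 0 s i) + (cfval (drop i.+1 s) x)^-1.
Proof. by move=> si; rewrite (drop_nth 0 si). Qed.

Lemma polypart_cfval_drop i : (i <= size s)%N ->
  is_polypart (cfval (drop i s) x) (nth 0 (rcons s e) i).
Proof.
rewrite leq_eqVlt nth_rcons => /orP[/eqP ->|si].
  by rewrite ltnn eqxx drop_size.
by rewrite si cfval_drop //; apply: polypart_addV; apply: cfval_drop_big.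
Qed.

(** Up to index [size s] each step of the expansion is forced. If [x] is a polynomial, its
    fractional part is zero, which [cf_next] excludes, so the expansion ends there. *)
Lemma complete_quotient_cfval y i (z : int -> K) : y = cfval s x ->
  complete_quotient y i z ->
  ((i <= size s)%N -> z = cfval (drop i s) x :> (int -> K)) /\
  ((size s < i)%N -> x <> lp e).
Proof.
move=> yE cq; elim: i z / cq => [|i b c _ [IHle IHgt] [p [bp [nz pr]]]].
  by split=> // _; rewrite drop0 yE.
split=> [si|].
  have zE := IHle (ltnW si); subst b.
  have pE := polypart_uniq (polypart_cfval_drop (ltnW si)) bp; subst p.
  case: (pr) => Mf [Mg [_ [cM _]]].
  pose c' : L := Laurent (ex_intro _ Mg cM).
  suff -> : cfval (drop i.+1 s) x = c' by [].
  rewrite (is_prodE (a := cfval (drop i s) x - lp (nth 0 (rcons s e) i)) (b := c') nz _ pr) //.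
  by rewrite (cfval_drop si) nth_rcons si addrAC subrr add0r invrK.
rewrite ltnS leq_eqVlt => /orP[/eqP si|/IHgt //] xE.
have zE := IHle (eq_leq (esym si)); subst b.
have pE := polypart_uniq (polypart_cfval_drop (eq_leq (esym si))) bp; subst p.
case: nz => k; rewrite /lsub -si nth_rcons ltnn eqxx drop_size /= xE.
by rewrite subrr eqxx.
Qed.

End Expansion.

(** Either the prefix is long enough to contain the two indices compared, or [x] is a polynomial and
    no complete quotient lies beyond it. The polynomial part [e] of [x] is the partial quotient of
    index [size s]. *)
Lemma inGprime_expansions y :
  (forall N : nat, exists s x e, [/\ is_polypart x e, increasing (rcons s e),
     s <> [::] -> big x, y = cfval s x & (N <= size s)%N \/ x = lp e]) ->
  inGprime y.
Proof.
move=> h i p r i1 [z [zi zp]] [z' [zi' zr]].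
have [s [x [e [xe inc xb yE N]]]] := h i.+1.
have si : (i < size s)%N.
  rewrite ltnNge; apply/negP => si.
  have := (complete_quotient_cfval xe inc xb yE zi').2; rewrite ltnS => /(_ si).
  by case: N => //; lia.
have zE := (complete_quotient_cfval xe inc xb yE zi).1 (ltnW si).
have zE' := (complete_quotient_cfval xe inc xb yE zi').1 si; subst z z'.
rewrite -(polypart_uniq (polypart_cfval_drop xe inc xb (ltnW si)) zp).
rewrite -(polypart_uniq (polypart_cfval_drop xe inc xb si) zr).
have sz : (i < size (tail_degs (rcons s e)))%N.
  by rewrite size_map size_behead size_rcons.
have := pathP 0%N inc i sz.
(* Position [i] of [tail_degs] holds the degree of index [i + 1]. As [1 <= i], its predecessor in
   the path is the degree of index [i], not the initial 0. *)
case: i i1 si sz {N zi zp zi' zr} => // i _ si sz; rewrite -[nth _ (_ :: _) _]/(nth 0%N (tail_degs (rcons s e)) i).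
by rewrite !(nth_map 0) ?nth_behead // -(size_map (@pdeg K)) // ltnW.
Qed.

(* The convergent [x = p / q] of [w], with previous denominator [q']; [sg = ±1]
   is the determinant of the matrix of convergents. *)
Definition convergent w x := exists s e (q q' sg : L),
  [/\ w = rcons s e, x = cfval s (lp e), increasing w &
   [/\ has_deg q (den_deg w), deg_le q' ((den_deg w)%:Z - 1), has_deg sg 0 &
    forall y, big y -> cfval w y = x + sg / (q * (q * y + q'))]].

Lemma convergent_neq_nil w x : convergent w x -> w <> [::].
Proof. by case=> [s [e [_ [_ [_ [-> _ _ _]]]]]]; case: s. Qed.

Lemma convergent1 (p : {poly K}) : convergent [:: p] (lp p).
Proof.
exists [::], p, 1, 0, 1; split=> //; split=> [||| y _]; try exact: has_deg1.
  by [].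
by rewrite /= !mul1r addr0.
Qed.

Lemma has_deg_den (q q' y : L) (d m : int) : 1 <= m -> has_deg q d ->
  deg_le q' (d - 1) -> has_deg y m -> has_deg (q * y + q') (d + m).
Proof.
move=> m1 qd qd' ym; apply: has_degD; first exact: has_degM.
by apply: deg_le_trans qd'; lia.
Qed.

(** The classical recurrence: the new denominator is q p + q', the old [q] becomes the previous one,
    and the determinant changes sign. *)
Lemma convergent_rcons w x (p : {poly K}) : convergent w x ->
  (last_deg w < pdeg p)%N -> convergent (rcons w p) (cfval w (lp p)).
Proof.
move=> wx wp; have w0 := convergent_neq_nil wx.
case: wx => [s [e [q [q' [sg [_ xE inc [qd qd' sgd val]]]]]]].
have p0 : (0 < pdeg p)%N by apply: leq_ltn_trans wp.
have pb := big_lp p0.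
have pd : has_deg (lp p) (pdeg p)%:Z.
  by apply: has_deg_lp; apply: contraTneq p0 => ->; rewrite /pdeg size_poly0.
have q1d : has_deg (q * lp p + q') ((den_deg w)%:Z + (pdeg p)%:Z).
  by apply: has_deg_den.
exists w, p, (q * lp p + q'), q, (- sg); split=> //.
  by rewrite increasing_rcons // inc.
rewrite den_deg_rcons //; split=> //.
- by case: qd => _ qM; apply: deg_le_trans qM; lia.
- exact: has_degN.
move=> y yb; rewrite -[cfval _ _]/(foldr _ _ _) foldr_rcons -[foldr _ _ _]/(cfval w (lp p + y^-1)).
rewrite val; last exact: big_addV.
rewrite val //.
have y0 := big_neq0 yb; have q0 := has_deg_neq0 qd; have q10 := has_deg_neq0 q1d.
have den0 : (q * lp p + q') * y + q != 0.
  case: yb => m m1 ym; apply: (@has_deg_neq0 _ _ ((den_deg w)%:Z + (pdeg p)%:Z + m)).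
  apply: has_deg_den => //.
  by case: qd => _ qM; apply: deg_le_trans qM; lia.
by field; rewrite y0 q0 q10 den0.
Qed.

(** The equation eps = sg / (q (q y + q')) is solved for [y]. Since D > 2 deg q, the term sg / (q
    eps) dominates q' and fixes the degree of [y]. *)
Lemma convergent_tail w x (eps : L) D : convergent w x -> has_deg eps (- D) ->
  2 * (den_deg w)%:Z + (last_deg w)%:Z < D ->
  exists2 y : L, has_deg y (D - 2 * (den_deg w)%:Z) & x + eps = cfval w y.
Proof.
move=> [s [e [q [q' [sg [_ xE inc [qd qd' sgd val]]]]]]] epsD hD.
have q0 := has_deg_neq0 qd; have e0 := has_deg_neq0 epsD; have sg0 := has_deg_neq0 sgd.
pose y := (sg / (q * eps) - q') / q.
have yd : has_deg y (D - 2 * (den_deg w)%:Z).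
  have -> : D - 2 * (den_deg w)%:Z = (0 + (- ((den_deg w)%:Z + - D))) + (- (den_deg w)%:Z).
    by lia.
  apply: has_degM; last exact: has_degV.
  apply: has_degD; first by apply: has_degM => //; apply: has_degV; apply: has_degM.
  by apply: deg_leN; apply: deg_le_trans qd'; lia.
exists y => //; rewrite val; last by exists (D - 2 * (den_deg w)%:Z) => //; lia.
have -> : q * y + q' = sg / (q * eps) by rewrite /y; field; rewrite q0 e0.
by field; rewrite q0 e0 sg0.
Qed.

(** In the difference of the two values a factor [q] cancels, leaving sg (z - y) / ((q y + q') (q z
    + q')). It is applied with [z] the polynomial part of [y]. *)
Lemma convergent_close w x y (z : L) m : convergent w x -> 1 <= m ->
  has_deg y m -> has_deg z m -> deg_le (y - z) (- 1) ->
  deg_le (cfval w y - cfval w z) (- (2 * ((den_deg w)%:Z + m)) - 1).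
Proof.
move=> [s [e [q [q' [sg [_ xE inc [qd qd' sgd val]]]]]]] m1 ym zm yz.
have q0 := has_deg_neq0 qd.
have yq := has_deg_den m1 qd qd' ym; have zq := has_deg_den m1 qd qd' zm.
have y0 := has_deg_neq0 yq; have z0 := has_deg_neq0 zq.
rewrite !val; [|by exists m|by exists m].
have -> : x + sg / (q * (q * y + q')) - (x + sg / (q * (q * z + q'))) =
    - (sg * (y - z) * ((q * y + q') * (q * z + q'))^-1).
  by field; rewrite y0 q0 z0.
apply: deg_leN.
have -> : - (2 * ((den_deg w)%:Z + m)) - 1 = (0 + - 1) + - ((den_deg w)%:Z + m + ((den_deg w)%:Z + m)).
  by lia.
apply: deg_leM; first by apply: deg_leM => //; case: sgd.
by case: (has_degV (has_degM yq zq)).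
Qed.

Lemma convergent_extend w x (eps : L) D : convergent w x -> has_deg eps (- D) ->
  2 * (den_deg w)%:Z + (last_deg w)%:Z < D ->
  exists p x', [/\ convergent (rcons w p) x', (pdeg p)%:Z = D - 2 * (den_deg w)%:Z &
    deg_le (x + eps - x') (- (2 * (D - (den_deg w)%:Z)) - 1)].
Proof.
move=> wx epsD hD; have [y yd ->] := convergent_tail wx epsD hD.
have [p yp] := polypart_ex y.
have [|pd p0] := has_deg_polypart _ yd yp; first by lia.
exists p, (cfval w (lp p)); split=> //; first by apply: (convergent_rcons wx); lia.
have -> : D - (den_deg w)%:Z = (den_deg w)%:Z + (D - 2 * (den_deg w)%:Z) by lia.
apply: convergent_close wx _ yd _ _; first by lia.
  by rewrite -pd; apply: has_deg_lp.
exact/polypart_deg_le.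
Qed.

End ContinuedFractions.

(** * The alternating construction *)

Section Decomposition.
Variables (K : fieldType) (alpha : laurent K).
Local Notation L := (laurent K).
Implicit Types (u v : seq {poly K} * L).

Definition residue u v : L := alpha - u.2 - v.2.

(* [v] was extended last and [u] is extended next; the size condition only
   ensures that the expansions grow for as long as the residue is nonzero. *)
Definition balanced (n : nat) u v :=
  [/\ convergent u.1 u.2, convergent v.1 v.2 &
      residue u v = 0 \/
      [/\ (n <= 2 * size u.1)%N /\ (n < 2 * size v.1)%N,
          deg_le (residue u v) (- (2 * den_deg v.1)%:Z - 1),
          deg_le (residue u v) (- (2 * den_deg u.1 + last_deg u.1)%:Z - 1) &
          (2 * den_deg u.1 + last_deg v.1 <= 2 * den_deg v.1)%N]].

Lemma balanced_step n u v : balanced n u v ->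
  exists u', balanced n.+1 v u' /\
    forall m, deg_le (residue u v) m -> deg_le (residue v u') (m - 1).
Proof.
have resC u' : residue v u' = residue u v + u.2 - u'.2 by rewrite /residue; ring.
move=> [cu cv inv]; have [r0|r0] := eqVneq (residue u v) 0.
  have r0' : residue v u = 0 by rewrite resC r0 add0r subrr.
  (* A zero residue stays zero: the fractions are kept and only exchanged. *)
  by exists u; split; [split=> //; left|rewrite r0'].
case: inv => [/eqP|[[nu nv] rv ru qv]]; first by rewrite (negPf r0).
have [m rm] := has_deg_ex r0.
have [hv hu] := (has_deg_le rm rv, has_deg_le rm ru).
have rD : has_deg (residue u v) (- - m) by rewrite opprK.
have [|p [x' [cu' pd close]]] := convergent_extend cu rD; first by lia.
have u0 := convergent_neq_nil cu.
exists (rcons u.1 p, x'); split=> [|k rk]; last first.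
  have := has_deg_le rm rk; rewrite resC addrAC => mk.
  have -> : residue u v - x' + u.2 = u.2 + residue u v - x' by ring.
  (* Let D be [- m], and q, s the denominators of [u], [v]. The new residue has degree at most -2 (D
     - deg q) - 1, hence at most -D - 1 because D > 2 deg q. *)
  by apply: deg_le_trans close; lia.
split=> //; right.
have -> : residue v (rcons u.1 p, x') = u.2 + residue u v - x' by rewrite resC /=; ring.
rewrite [(_, _).1]/= size_rcons den_deg_rcons // last_deg_rcons //.
split; first by lia.
- by apply: deg_le_trans close; lia.
(* From D > 2 deg s and 2 deg s >= 2 deg q + e follows 2 (D - deg q) > 2 deg s + e. *)
- by apply: deg_le_trans close; lia.
(* The inequality 2 deg s + (D - 2 deg q) <= 2 (D - deg q) amounts to 2 deg s <= D. *)
- by lia.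
Qed.

(** The first fraction takes the whole polynomial part and the second is 0. Both denominators are 1,
    so only a residue of negative degree is required. *)
Lemma balanced_start : exists u v, balanced 0 u v /\ deg_le (residue u v) (- 1).
Proof.
have [p ap] := polypart_ex alpha.
exists ([:: p], lp p), ([:: 0], lp 0).
have r1 : deg_le (residue ([:: p], lp p) ([:: 0], lp 0)) (- 1).
  by rewrite /residue lp0 subr0; apply/polypart_deg_le.
by split=> //; split; [exact: convergent1|exact: convergent1|right].
Qed.

(** Stage [n] pairs [w n], extended next, with [w n.+1]; the two fractions thus occupy the even and
    the odd indices. *)
Lemma balanced_sequence : exists w : nat -> seq {poly K} * L,
  [/\ forall n, balanced n (w n) (w n.+1), deg_le (residue (w 0%N) (w 1%N)) (- 1) &
      forall n m, deg_le (residue (w n) (w n.+1)) m ->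
        deg_le (residue (w n.+1) (w n.+2)) (m - 1)].
Proof.
pose good (t : nat * (seq {poly K} * L) * (seq {poly K} * L)) u' :=
  let: (n, u, v) := t in balanced n u v ->
  balanced n.+1 v u' /\
    forall m, deg_le (residue u v) m -> deg_le (residue v u') (m - 1).
have [f fP] : {f & forall t, good t (f t)}.
  apply: boolp.choice => -[[n u] v]; have [/balanced_step[u' h]|h] := pselect (balanced n u v).
    by exists u'.
  by exists u => /h.
have [u [v [uv r1]]] := balanced_start.
pose st := fix st n := if n is n'.+1 then ((st n').2, f (n', (st n').1, (st n').2)) else (u, v).
have stP n : balanced n (st n).1 (st n).2.
  by elim: n => //= n /(fP (n, (st n).1, (st n).2)) [].
by exists (fun n => (st n).1); split=> // n; case: (fP (n, (st n).1, (st n).2) (stP n)).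
Qed.

End Decomposition.

(** * Limits of Laurent series *)

Section Limits.
Variable K : fieldType.
Local Notation L := (laurent K).

(** The coefficient of t^k is constant from index |k| + 1 on, where increments have degree below
    [k]. The bound [m] is left free so that limits can be compared at the exact degree of a
    residue. *)
Lemma laurent_limit (z : nat -> L) :
  (forall i, deg_le (z i.+1 - z i) (- i%:Z)) ->
  exists y : L, forall i m, (forall j, (i <= j)%N -> deg_le (z j.+1 - z j) m) ->
    deg_le (y - z i) m.
Proof.
move=> zi; pose y k := z (absz k).+1 k.
have const i j k : (forall l, (i <= l)%N -> z l.+1 k = z l k) -> (i <= j)%N -> z j k = z i k.
  move=> h; elim: j => [|j IH]; first by rewrite leqn0 => /eqP ->.
  by rewrite leq_eqVlt => /orP[/eqP ->|ij] //; rewrite h // IH.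
have yz i (m k : int) : (forall j, (i <= j)%N -> deg_le (z j.+1 - z j) m) -> m < k ->
    y k = z i k.
  move=> h mk; rewrite /y -(const i (maxn i (absz k).+1)) ?leq_maxl //; last first.
    by move=> l il; apply/eqP; rewrite -subr_eq0; apply/eqP; apply: h mk.
  apply/esym/const; last exact: leq_maxr.
  move=> l il; apply/eqP; rewrite -subr_eq0; apply/eqP; apply: (zi l); lia.
(* Every increment has degree at most 0, so in positive degrees [y] agrees with [z 0]. *)
have yl : is_laurent y.
  have [M zM] := lcoef_bounded (z 0%N); exists (Num.max M 0) => k.
  rewrite gt_max => /andP[Mk k0]; rewrite (yz 0%N 0) ?zM // => j _.
  by apply: deg_le_trans (zi j); lia.
exists (Laurent yl) => i m h k mk; rewrite laurentD laurentN /= (yz i m) ?subrr //.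
Qed.

End Limits.

(** * The limits of the two fractions lie in G' *)

Section Sums.
Variables (K : fieldType) (alpha : laurent K) (w : nat -> seq {poly K} * laurent K).
Hypothesis w_bal : forall n, balanced alpha n (w n) (w n.+1).
Local Notation r n := (residue alpha (w n) (w n.+1)).
Hypothesis r0 : deg_le (r 0%N) (- 1).
Hypothesis r_step : forall n m, deg_le (r n) m -> deg_le (r n.+1) (m - 1).

Lemma residue_le n m k : (n <= k)%N -> deg_le (r n) m -> deg_le (r k) (m - (k - n)%N%:Z).
Proof.
move=> nk rn; rewrite -{1 2}(subnKC nk); elim: (k - n)%N => [|i IH].
  by rewrite addn0 subr0.
rewrite addnS; have -> : m - i.+1%:Z = m - i%:Z - 1 by lia.
exact: r_step.
Qed.

Lemma residue_bound n : deg_le (r n) (- n%:Z - 1).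
Proof. by apply: deg_le_trans (residue_le (leq0n n) r0); lia. Qed.

Lemma residue_diff n : (w n.+2).2 - (w n).2 = r n - r n.+1.
Proof. by rewrite /residue; ring. Qed.

(** The values 0 and 1 of [e] select the even and the odd terms. If the residue vanishes at stage
    [2 * N + e], the subsequence is constant from [N] on and [y] is a rational function. Otherwise
    [y - z N] is as small as the residue, and [convergent_tail] makes the [N]-th expansion an
    initial segment of that of [y]. *)
Lemma half_limit (e : nat) : exists y, inGprime y /\
  forall i, deg_le (y - (w (2 * i + e)).2) (- i%:Z).
Proof.
pose z i := (w (2 * i + e)).2.
have zS i : z i.+1 - z i = r (2 * i + e) - r (2 * i + e).+1.
  by rewrite -residue_diff /z; have -> : (2 * i.+1 + e = (2 * i + e).+2)%N by lia.
have zle i j m : (i <= j)%N -> deg_le (r (2 * i + e)) m -> deg_le (z j.+1 - z j) m.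
  move=> ij ri; have rj : deg_le (r (2 * j + e)) m.
    by apply: deg_le_trans (residue_le _ ri); lia.
  by rewrite zS; apply: deg_leB => //; apply: deg_le_trans (r_step rj); lia.
have zi i : deg_le (z i.+1 - z i) (- i%:Z).
  by apply: (zle i i) => //; apply: deg_le_trans (@residue_bound (2 * i + e)); lia.
have [y yz] := laurent_limit zi.
exists y; split=> [|i]; last first.
  by apply: yz => j ij; apply: deg_le_trans (zi j); lia.
apply: inGprime_expansions => N; set n := (2 * N + e)%N.
have [cw _ inv] := w_bal n.
have [rn0|rn0] := eqVneq (r n) 0.
  have yE : y = z N.
    apply/eqP; rewrite -subr_eq0; apply/eqP; apply: deg_le_eq0 => k.
    by apply: yz => j Nj; apply: (zle N) => //; rewrite -/n rn0.
  case: cw => [s [p [_ [_ [_ [wE xE inc _]]]]]].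
  exists s, (lp p), p; rewrite -wE; split=> //.
  - move=> s0; apply: big_lp; apply: (increasing_gt0 inc); rewrite wE.
    by case: s s0 {wE xE} => // p' s _; rewrite mem_rcons mem_head.
  - by rewrite yE -xE.
  by right.
case: inv => [/eqP|[[nw _] _ ru _]]; first by rewrite (negPf rn0).
have [m rm] := has_deg_ex rn0; have hm := has_deg_le rm ru.
(* The increment [z N.+1 - z N] is [r n - r n.+1]; [r n.+1] and all later increments have degree at
   most [m - 1], so [r n] gives the leading term. *)
have eps : has_deg (y - z N) (- - m).
  have -> : y - z N = r n + (y - z N.+1 - r n.+1).
    have /eqP := zS N; rewrite subr_eq -/n => /eqP ->; ring.
  have rn1 : deg_le (r n.+1) (m - 1) by apply: r_step; case: rm.
  rewrite opprK; apply: has_degD => //; apply: deg_leB => //.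
  apply: yz => j Nj; apply: (zle N.+1) => //.
  have -> : (2 * N.+1 + e = n.+2)%N by rewrite /n; lia.
  by apply: deg_le_trans (r_step rn1); lia.
have [|x xd] := convergent_tail cw eps; first by lia.
rewrite -/(z N) addrC subrK => yE.
have [p xp] := polypart_ex x.
have [|pd p0] := has_deg_polypart _ xd xp; first by lia.
exists (w n).1, x, p; split=> //.
- have w0 := convergent_neq_nil cw; rewrite increasing_rcons //.
  by case: cw => [s [q [_ [_ [_ [_ _ -> _]]]]]] /=; lia.
- by move=> _; exists (- m - 2 * (den_deg (w n).1)%:Z) => //; lia.
by left; lia.
Qed.

End Sums.

Theorem theorem1p4 (K : fieldType) (alpha : laurent K) :
  exists beta gamma : laurent K,
    inGprime beta /\ inGprime gamma /\
    forall k : int, alpha k = beta k + gamma k.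
Proof.
have [w [wb r0 rS]] := balanced_sequence alpha.
have [beta [bG bw]] := half_limit wb r0 rS 0.
have [gamma [gG gw]] := half_limit wb r0 rS 1.
exists beta, gamma; split=> //; split=> // k.
suff -> : alpha = beta + gamma by [].
apply/eqP; rewrite -subr_eq0; apply/eqP; apply: deg_le_eq0 => i.
have := bw i; have := gw i; rewrite addn0 addn1 => gi bi.
(* The residue has degree at most -2 i - 1 and the two errors have degree at most -i. *)
have -> : alpha - (beta + gamma) = residue alpha (w (2 * i)%N) (w (2 * i).+1)
    - (beta - (w (2 * i)%N).2) - (gamma - (w (2 * i).+1).2).
  by rewrite /residue; ring.
apply: deg_leB => //; apply: deg_leB => //.
by apply: deg_le_trans (residue_bound r0 rS (n := 2 * i)); lia.
Qed.
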